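(* Let $(P,\leq)=(P,\land,\lor)$ be a lattice in which every principal order ideal $\{y\in P: y\le x\}$ is finite, and let $f:P\to\mathbb{C}$ be semimultiplicative with $f(x)\neq 0$ for all $x\in P$. Let $S=\{x_1,\ldots,x_n\}$ be a meet closed subset of $P$ with distinct elements, indexed so that $x_i<x_j\Rightarrow i<j$. Then the join matrix $[S]_f$ is invertible if and only if $$\Big(\tfrac{1}{f}*_S\mu_S\Big)(x_i)=\sum_{y\in S,\ y\le x_i}\frac{\mu_S(y,x_i)}{f(y)}\neq 0\qquad\text{for all } i=1,\ldots,n.$$
   Context: $f$ is semimultiplicative if $f(x)f(y)=f(x\land y)f(x\lor y)$ for all $x,y\in P$. A subset $S$ is meet closed if $x,y\in S\Rightarrow x\land y\in S$. The join matrix $[S]_f$ is the $n\times n$ matrix with $(i,j)$ entry $f(x_i\lor x_j)$. $\mu_S$ denotes the Möbius function of the finite poset $(S,\le)$: $\mu_S(x,x)=1$, $\mu_S(x,y)=-\sum_{z\in S,\,x\le z<y}\mu_S(x,z)$ for $x<y$, and $\mu_S(x,y)=0$ if $x\not\le y$. (In the paper this is phrased as: $[S]_f$ is invertible iff all conditions of the inductive construction sequence of $S$ hold, the $i$-th condition being the displayed nonvanishing.) *)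

(* Defs.v *)
From HB Require Import structures.
From mathcomp Require Import all_boot all_order all_algebra.

Set Implicit Arguments.
Unset Strict Implicit.
Unset Printing Implicit Defensive.

Import Order.TTheory GRing.Theory Num.Theory.
Local Open Scope ring_scope.

Section LatticeNotions.
Context {d : Order.disp_t} {P : latticeType d}.

Definition semimultiplicative (K : pzRingType) (f : P -> K) : Prop :=
  forall x y : P, f x * f y = f (Order.meet x y) * f (Order.join x y).

Definition join_matrix (K : Type) (f : P -> K) (n : nat) (x : n.-tuple P) :
    'M[K]_n :=
  \matrix_(i, j) f (Order.join (tnth x i) (tnth x j)).

End LatticeNotions.

Section Mobius.
Context {d : Order.disp_t} {P : porderType d}.

(* A finite subset of P is given as a duplicate-free sequence S. The argument
   k bounds the recursion depth: a chain of S has at most [size S] elements,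
   so k = size S never runs out and the defining recurrence holds, see
   mobius_lt below. *)
Fixpoint mobius_rec (S : seq P) (k : nat) (x y : P) : int :=
  if x == y then 1
  else if (x < y)%O then
    if k is k'.+1 then - \sum_(z <- S | (x <= z < y)%O) mobius_rec S k' x z
    else 0
  else 0.

Definition mobius (S : seq P) (x y : P) : int := mobius_rec S (size S) x y.

Lemma mobius_recxx (S : seq P) k x : mobius_rec S k x x = 1.
Proof. by case: k => [|k] /=; rewrite eqxx. Qed.

Lemma mobius_rec_stable (S : seq P) k l x y : x \in S ->
  (count (fun z => x <= z < y)%O S <= k)%N ->
  (count (fun z => x <= z < y)%O S <= l)%N ->
  mobius_rec S k x y = mobius_rec S l x y.
Proof.
move=> xS.
have pos y' : (x < y')%O -> (0 < count (fun z => x <= z < y')%O S)%N.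
  by move=> lxy'; rewrite -has_count; apply/hasP; exists x;
     rewrite ?lexx ?lxy'.
elim: k l y => [|k IHk] [|l] y //= hk hl;
  case: eqVneq => // nxy; case: ifP => // /[dup] lxy /pos.
- by rewrite ltnNge hk.
- by rewrite ltnNge hl.
move=> _.
congr (- _); rewrite big_seq_cond [RHS]big_seq_cond.
apply: eq_bigr => z /andP[zS /andP[lxz lzy]].
suff H : (count (fun w => x <= w < z)%O S < count (fun w => x <= w < y)%O S)%N.
  by apply: IHk; rewrite -ltnS; apply: leq_trans H _.
rewrite -!size_filter -(count_predC (pred1 z) (filter (fun w => x <= w < y)%O S)).
rewrite -[ltnLHS]add0n -addSn leq_add //.
  by rewrite -has_count has_pred1 mem_filter lxz lzy.
rewrite count_filter size_filter; apply: sub_count => w /= /andP[lxw lwz].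
by rewrite lxw (lt_trans lwz lzy) (lt_eqF lwz).
Qed.

Lemma mobiusxx (S : seq P) x : mobius S x x = 1.
Proof. exact: mobius_recxx. Qed.

Lemma mobius_lt (S : seq P) x y : x \in S -> (x < y)%O ->
  mobius S x y = - \sum_(z <- S | (x <= z < y)%O) mobius S x z.
Proof.
move=> xS lxy; rewrite /mobius.
rewrite (@mobius_rec_stable S (size S) (size S).+1) ?count_size //; last first.
  exact: leq_trans (count_size _ _) _.
by rewrite /= (lt_eqF lxy) lxy.
Qed.

Lemma mobius_nle (S : seq P) x y : ~~ (x <= y)%O -> mobius S x y = 0.
Proof.
rewrite /mobius; case: (size S) => [|k] /=; case: eqVneq => [->|_];
  rewrite ?lexx // => h; case: ifP => // /ltW; by rewrite (negPf h).
Qed.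

End Mobius.

(* Main.v *)
Require Import Defs.
From HB Require Import structures.
From mathcomp Require Import all_boot all_order all_algebra.
From mathcomp Require Import complex.
From mathcomp Require Import boolp classical_sets cardinality reals.

Set Implicit Arguments.
Unset Strict Implicit.
Unset Printing Implicit Defensive.

Import Order.TTheory GRing.Theory Num.Theory.
Local Open Scope ring_scope.
Local Open Scope complex_scope.

(** Semimultiplicativity turns the join matrix into [D M D], where
    [D = diag (f x_i)] and [M] is the meet matrix of [g = 1 / f]. For a meet
    closed [S], Möbius inversion on [S] gives [M = L (diag c) L^T], where
    [c_k = (g *_S mu_S) (x_k)] and [L] is the incidence matrix of the order
    of [S], which is lower unitriangular for the given indexing. Hence
    [det [S]_f = (prod_i f x_i)^2 (prod_k c_k)]. *)

Section MobiusInversion.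
Context {d : Order.disp_t} {P : porderType d} (S : seq P).

(** Splitting off [z = x], which occurs once since [S] is duplicate-free, leaves the half-open
    interval of the recurrence [mobius_lt]: for [y < x] the two parts cancel, and for [y = x] the
    half-open interval is empty. *)
Lemma sum_mobius (y x : P) : uniq S -> y \in S -> x \in S ->
  \sum_(z <- S | (y <= z <= x)%O) mobius S y z = (y == x)%:R.
Proof.
move=> S_uniq yS xS; have [lyx|nlyx] := boolP (y <= x)%O; last first.
  rewrite big1 => [|z /andP[/le_trans/[apply]]]; last by rewrite (negPf nlyx).
  by case: eqVneq nlyx => [->|//]; rewrite lexx.
rewrite big_mkcond (bigD1_seq x) //= lyx lexx -big_mkcondr /=.
rewrite (eq_bigl (fun z => y <= z < x)%O) => [|z]; last first.
  by rewrite lt_neqAle andbCA.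
case: eqVneq lyx => [->|nyx lyx].
  rewrite mobiusxx big1 ?addr0 // => z /andP[lxz /(le_lt_trans lxz)].
  by rewrite ltxx.
by rewrite mobius_lt ?addNr // lt_neqAle nyx.
Qed.

(** After exchanging the sums, the coefficient of each [g y] is a sum of [mobius S y z] over the
    interval from [y] to [x], which [sum_mobius] collapses to a Kronecker delta. *)
Lemma mobius_inversion (K : pzRingType) (g : P -> K) (x : P) :
  uniq S -> x \in S ->
  \sum_(z <- S | (z <= x)%O)
     \sum_(y <- S | (y <= z)%O) (mobius S y z)%:~R * g y = g x.
Proof.
move=> S_uniq xS; rewrite (exchange_big_dep predT) //=.
have inner y : y \in S ->
    \sum_(z <- S | (z <= x)%O && (y <= z)%O) (mobius S y z)%:~R * g y =
    (y == x)%:R * g y.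
  move=> yS; rewrite -mulr_suml -rmorph_sum /=.
  under eq_bigl => z do rewrite andbC.
  by rewrite sum_mobius //; case: (y == x).
rewrite (bigD1_seq x) //= inner // eqxx mul1r big_seq_cond big1 ?addr0 //.
by move=> y /andP[yS /negPf nyx]; rewrite inner // nyx mul0r.
Qed.

End MobiusInversion.

Section JoinMatrix.
Context {d : Order.disp_t} {P : latticeType d} {K : fieldType}.
Variables (n : nat) (S : n.-tuple P).
Hypothesis S_uniq : uniq S.
Hypothesis S_order :
  forall i j : 'I_n, (tnth S i < tnth S j)%O -> (i < j)%N.
Hypothesis S_meet : meet_closed (mem S).

Definition zeta_matrix : 'M[K]_n :=
  \matrix_(i, k) (tnth S k <= tnth S i)%O%:R.

Lemma det_zeta_matrix : \det zeta_matrix = 1.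
Proof.
rewrite det_trig; first by apply: big1 => i _; rewrite mxE lexx.
apply/is_trig_mxP => i k lik; rewrite mxE le_eqVlt.
(* Above the diagonal, [i < k]: equal entries contradict distinctness, and a strict inequality would
   give [k < i] by [S_order]. *)
case: eqP => [/(tuple_uniqP _ S_uniq) eki|_ /=].
  by rewrite eki ltnn in lik.
by rewrite (contraNF (@S_order k i)) // -leqNgt ltnW.
Qed.

Definition mobius_row (g : P -> K) : 'rV[K]_n :=
  \row_k \sum_(y <- S | (y <= tnth S k)%O) (mobius S y (tnth S k))%:~R * g y.

Lemma meet_matrix_factor (g : P -> K) :
  \matrix_(i, j) g (Order.meet (tnth S i) (tnth S j)) =
  zeta_matrix *m diag_mx (mobius_row g) *m zeta_matrix^T.
Proof.
(* Inversion is applied at the meet of the two entries; this is where [S_meet] enters. *)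
apply/matrixP => i j; rewrite !mxE -(mobius_inversion g S_uniq); last first.
  by apply: S_meet; apply: mem_tnth.
rewrite big_tuple big_mkcond; apply: eq_bigr => k _.
(* An element lies below the meet iff it lies below both entries, so the product of the two
   incidence entries is the indicator of the summation range. *)
by rewrite mul_mx_diag !mxE lexI; do 2 case: (_ <= _)%O;
  rewrite /= ?mul1r ?mulr1 ?mul0r ?mulr0.
Qed.

Lemma join_matrix_factor (f : P -> K) :
  semimultiplicative f -> (forall x, f x != 0) ->
  let D := diag_mx (\row_i f (tnth S i)) in
  join_matrix f S =
  D *m (\matrix_(i, j) (f (Order.meet (tnth S i) (tnth S j)))^-1) *m D.
Proof.
move=> fM f_neq0 D; apply/matrixP => i j.
(* Semimultiplicativity rewrites [f x_i * f x_j], and the factor at the meet then cancels against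
   its inverse. *)
by rewrite mul_mx_diag mul_diag_mx !mxE mulrAC fM mulrAC mulfV ?mul1r.
Qed.

Lemma det_join_matrix (f : P -> K) :
  semimultiplicative f -> (forall x, f x != 0) ->
  \det (join_matrix f S) =
  (\prod_i f (tnth S i)) ^+ 2 *
  \prod_i \sum_(y <- S | (y <= tnth S i)%O) (mobius S y (tnth S i))%:~R / f y.
Proof.
move=> fM f_neq0; rewrite join_matrix_factor //.
rewrite (meet_matrix_factor (fun x => (f x)^-1)) !det_mulmx det_tr.
rewrite det_zeta_matrix mul1r mulr1 !det_diag mulrAC -expr2.
by congr (_ ^+ 2 * _); apply: eq_bigr => i _; rewrite mxE.
Qed.

End JoinMatrix.

Theorem theorem3p2 (R : realType) (d : Order.disp_t) (P : latticeType d)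
    (finite_ideals : forall x : P, finite_set [set y : P | (y <= x)%O]%classic)
    (f : P -> R[i])
    (f_semimult : semimultiplicative f)
    (f_neq0 : forall x : P, f x != 0)
    (n : nat) (S : n.-tuple P)
    (S_uniq : uniq S)
    (S_order : forall i j : 'I_n, (tnth S i < tnth S j)%O -> (i < j)%N)
    (S_meet : meet_closed (mem S)) :
  join_matrix f S \in unitmx <->
  (forall i : 'I_n,
     \sum_(y <- S | (y <= tnth S i)%O)
        (mobius S y (tnth S i))%:~R / f y != 0).
Proof.
rewrite unitmxE unitfE det_join_matrix // mulf_eq0 expf_eq0 /=.
(* Since [f] never vanishes, only the product of the convolution values can make the determinant
   zero. *)
have /negPf-> : \prod_i f (tnth S i) != 0 by apply/prodf_neq0.
split=> [/prodf_neq0 c_neq0 i|c_neq0]; first exact: c_neq0.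
by apply/prodf_neq0 => i _.
Qed.
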